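(* Assume that, after local trivialization, $\mathcal F(g,f)=\tau_g(f)$ is a smooth map between fixed Banach spaces, and that the normalized Jacobi operator $J_{g_0}=D_f\mathcal F(g_0,f_0):T_{f_0}\mathcal H^{k+2,\alpha}\to\mathcal Y^{k,\alpha}_{f_0}$ is a bounded isomorphism. Then there exist neighbourhoods $g_0\in\mathcal U\subset\mathcal G$ and $f_0\in\mathcal V\subset\mathcal H^{k+2,\alpha}$ and a unique smooth map $\Pi:\mathcal U\to\mathcal V$, $\Pi(g)=f_g$, such that $\mathcal F(g,f_g)=0$ for every $g\in\mathcal U$. Moreover, for $g\in\mathcal U$ every solution $f\in\mathcal V$ of $\mathcal F(g,f)=0$ coincides with $f_g$. Let $S_{\mathcal U}:=\mathbf g^{-1}(\mathcal U)=\{p\in S:g_p\in\mathcal U\}$. Then the composition $p\mapsto\Pi(g_p)$ is a unique smooth family of canonical harmonic probes on $S_{\mathcal U}$ near $p_0$ (that is, the unique such family with values in $\mathcal V$ of maps $f_p$ with $\tau_{g_p}(f_p)=0$).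
   Context: $M$ is a compact manifold with a smooth cohomogeneity-one action of a Lie group $\mathsf G$ with orbit space a closed interval. A normalized Einstein metric is a $\mathsf G$-invariant metric $g$ with $\operatorname{Ric}(g)=\lambda g$ ($\lambda>0$ fixed), normalized by a fixed unit-speed normal geodesic joining the two singular orbits. A smooth parameterized Einstein family is a smooth finite-dimensional manifold $S$ together with normalized Einstein metrics $g_p$, $p\in S$, whose coefficients depend smoothly on $(p,x)\in S\times M$; $\mathbf g$ denotes the map $p\mapsto g_p$, and $p_0\in S$ satisfies $g_{p_0}=g_0$. Fixed probe data: a compact Riemannian target $(N,h)$; a compatible action of $\mathsf G$ on $N$; an equivariant homotopy class of maps $M\to N$; endpoint, smoothness and normalization conditions removing the relevant probe symmetries; and a reference harmonic map $f_0:(M,g_0)\to(N,h)$ in the chosen class satisfying these conditions. Standing hypotheses: $k\ge4$, $0<\alpha<1$; the prescribed equivariance, endpoint, regularity and normalization constraints cut out a smooth Banach submanifold $\mathcal H^{k+2,\alpha}$ of the $C^{k+2,\alpha}$ mapping space $M\to N$; $\mathcal G$ is a Banach manifold of normalized cohomogeneity-one metrics on $M$ containing the metrics $g_p$, and $\mathbf g$ is smooth as a map into it; $\mathcal Y^{k,\alpha}$ is the Banach bundle whose fibre $\mathcal Y^{k,\alpha}_f$ consists of the equivariant $C^{k,\alpha}$ sections of $f^*TN$. $\tau_g(f)$ is the tension field of $f:(M,g)\to(N,h)$, so $\mathcal F(g,f)=0$ is the equivariant harmonic-map equation, and $\mathcal F(g_0,f_0)=0$. ''Canonical harmonic probe''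 of $g$ means the unique local continuation $f_g$ of the fixed reference map $f_0$. *)

(* Defs.v *)
From HB Require Import structures.
From mathcomp Require Import all_boot all_order all_algebra.
From mathcomp Require Import all_classical all_reals all_analysis.

Set Implicit Arguments.
Unset Strict Implicit.
Unset Printing Implicit Defensive.

Import Order.TTheory GRing.Theory Num.Theory.
Import numFieldNormedType.Exports.

Local Open Scope classical_set_scope.
Local Open Scope ring_scope.

(* [f] is [C^(n+1)] on the open set [U] when it is Frechet differentiable
   there and its derivative, seen as the map [(x, v) |-> df_x v] on
   [U * E], is [C^n].  In infinite dimensions continuity of this map is
   weaker than continuity of [x |-> df_x] in operator norm, so one level
   may be lost for finite [n]; requiring all [n] gives exactly the usual
   Frechet-smooth maps, and in finite dimensions each level is the usual
   one. *)
Fixpoint Cn (R : realType) (n : nat) :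
    forall E F : normedModType R, set E -> (E -> F) -> Prop :=
  match n with
  | 0 => fun E F U f => forall x, U x -> {for x, continuous f}
  | n'.+1 => fun E F U f =>
      (forall x, U x -> differentiable f x) /\
      @Cn R n' (E * E)%type F (U `*` setT) (fun z => 'd f (z.1) (z.2))
  end.

Definition smooth (R : realType) (E F : normedModType R) (U : set E)
  (f : E -> F) : Prop := forall n, Cn n U f.

(* Outside [cdom] and [ctgt] the values of [cmap] and [cinv] are junk. *)
Record chart (R : realType) (E : normedModType R) (M : topologicalType) :=
  Chart {
    cdom : set M;
    cmap :> M -> E;
    cinv : E -> M;
    cdom_open : open cdom;
    ctgt_open : open (cmap @` cdom);
    cmapK : forall x, cdom x -> cinv (cmap x) = x;
    cmap_cont : forall x, cdom x -> {for x, continuous cmap};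
    cinv_cont : forall y, (cmap @` cdom) y -> {for y, continuous cinv}
  }.

Definition ctgt (R : realType) (E : normedModType R) (M : topologicalType)
  (c : chart E M) : set E := c @` cdom c.

(* [chart_at x] is a preferred chart of the atlas around [x].  The tangent
   space at [x] is represented by the model [E] through this chart. *)
Record manifold (R : realType) (E : normedModType R) := Manifold {
  mcar :> topologicalType;
  atlas : set (chart E mcar);
  chart_at : mcar -> chart E mcar;
  chart_at_atlas : forall x, atlas (chart_at x);
  chart_at_dom : forall x, cdom (chart_at x) x;
  atlas_compat : forall a b, atlas a -> atlas b ->
    smooth (a @` (cdom a `&` cdom b)) (b \o cinv a)
}.

Lemma Cn_linear (R : realType) (n : nat) (E F : normedModType R)
  (U : set E) (f : {linear E -> F}) : continuous f -> Cn n U f.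
Proof.
elim: n => [|n IH] in E F U f *; move=> cf /=; first by move=> x _; exact: cf.
split; first by move=> x _; exact: linear_differentiable.
have -> : (fun z : E * E => 'd f (z.1) (z.2)) = f \o snd.
  by apply/funext => z /=; rewrite diff_lin.
apply: (IH _ _ _ (f \o snd : {linear (E * E)%type -> F})).
by move=> z; apply: continuous_comp; [exact: cvg_snd|exact: cf].
Qed.

Section model.
Context (R : realType) (E : normedModType R).

Definition id_chart : chart E E.
Proof.
refine (@Chart R E E setT id id openT _ _ _ _).
- by rewrite image_id; exact: openT.
- by [].
- by move=> x _; exact: cvg_id.
- by move=> x _; exact: cvg_id.
Defined.

Definition model : manifold E.
Proof.
refine (@Manifold R E E [set id_chart] (fun=> id_chart) _ _ _).
- by [].
- by [].
- move=> a b -> -> n.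
  apply: (@Cn_linear _ _ _ _ _ (idfun : {linear E -> E})) => x.
  exact: cvg_id.
Defined.

End model.

Section smooth_maps.
Context (R : realType) (E F H : normedModType R).
Implicit Types (A : manifold E) (B : manifold F) (C : manifold H).

Definition smooth_on A B (U : set A) (f : A -> B) : Prop :=
  (forall x, U x -> {for x, continuous f}) /\
  forall a b, atlas a -> atlas b ->
    smooth (a @` [set x | [/\ U x, cdom a x & cdom b (f x)]])
           (b \o f \o cinv a).

(* Smoothness of a map on an open subset of the product manifold [A * B]. *)
Definition smooth2_on A B C (U : set (A * B)) (f : A -> B -> C) : Prop :=
  (forall z, U z -> {for z, continuous (fun z => f z.1 z.2)}) /\
  forall a b c, atlas a -> atlas b -> atlas c ->
    smooth [set (a z.1, b z.2) | z in
             [set z | [/\ U z, cdom a z.1, cdom b z.2 & cdom c (f z.1 z.2)]]]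
           (fun y => c (f (cinv a y.1) (cinv b y.2))).

Definition mdiff A B (f : A -> B) (x : A) : E -> F :=
  'd (chart_at (f x) \o f \o cinv (chart_at x)) (chart_at x x).

Definition bounded_iso (T : E -> F) : Prop :=
  continuous T /\
  exists T' : F -> E, [/\ cancel T T', cancel T' T & continuous T'].

End smooth_maps.

(* Tangent vectors are row vectors; the matrix of a linear map acts on the
   right. *)
Section finite_dim.
Context (R : realType).

Definition smooth_manifold n (M : manifold 'rV[R]_n) : Prop :=
  hausdorff_space M /\ @second_countable M.

Definition compact_manifold n (M : manifold 'rV[R]_n) : Prop :=
  smooth_manifold M /\ compact [set: M].

Definition tmat m n (M : manifold 'rV[R]_m) (N : manifold 'rV[R]_n)
    (f : M -> N) (x : M) : 'M[R]_(m, n) :=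
  jacobian (chart_at (f x) \o f \o cinv (chart_at x)) (chart_at x x).

(* Components in the chart [d] of a tangent vector [v] at [x]. *)
Definition tcoord n (N : manifold 'rV[R]_n) (d : chart 'rV[R]_n N) (x : N)
    (v : 'rV[R]_n) : 'rV[R]_n :=
  v *m jacobian (d \o cinv (chart_at x)) (chart_at x x).

Definition basis n (i : 'I_n) : 'rV[R]_n := delta_mx 0 i.

Record lie_group d := LieGroup {
  lg_car :> manifold 'rV[R]_d;
  lg_smooth_manifold : smooth_manifold lg_car;
  lg1 : lg_car;
  lgM : lg_car -> lg_car -> lg_car;
  lgV : lg_car -> lg_car;
  lgA : associative lgM;
  lg1M : left_id lg1 lgM;
  lgVM : left_inverse lg1 lgV lgM;
  lgM_smooth : smooth2_on setT lgM;
  lgV_smooth : smooth_on setT lgV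
}.

Definition smooth_action d n (G : lie_group d) (X : manifold 'rV[R]_n)
    (act : G -> X -> X) : Prop :=
  [/\ forall x, act (lg1 G) x = x,
      forall a b x, act (lgM a b) x = act a (act b x)
    & smooth2_on setT act].

(* Derivative at the identity of the orbit map [a |-> a . x]; its row space
   is the tangent space of the orbit at [x]. *)
Definition orbit_mx d n (G : lie_group d) (X : manifold 'rV[R]_n)
    (act : G -> X -> X) (x : X) : 'M[R]_(d, n) :=
  tmat (act^~ x) (lg1 G).

(* The orbits of maximal dimension have codimension one. *)
Definition cohomogeneity_one d n (G : lie_group d) (X : manifold 'rV[R]_n)
    (act : G -> X -> X) : Prop :=
  (forall x, (\rank (orbit_mx act x)).+1 <= n)%N /\
  exists x, (\rank (orbit_mx act x)).+1 = n.

(* [q] identifies the orbit space with the closed interval [0, 1]. *)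
Definition orbit_interval d n (G : lie_group d) (X : manifold 'rV[R]_n)
    (act : G -> X -> X) (q : X -> R) : Prop :=
  [/\ range q = [set t | 0 <= t <= 1],
      forall x y, q x = q y <-> exists a, y = act a x
    & forall A : set R,
        open (q @^-1` A) <-> exists2 B, open B & q @^-1` A = q @^-1` B].

Definition equivariant d m n (G : lie_group d) (X : manifold 'rV[R]_m)
    (Y : manifold 'rV[R]_n) (actX : G -> X -> X) (actY : G -> Y -> Y)
    (f : X -> Y) : Prop :=
  forall a x, f (actX a x) = actY a (f x).

(* [g x] is the Gram matrix of the metric at [x] in the chart [chart_at x];
   [metric_in g c] is the Gram matrix of [g] in the coordinates of [c]. *)
Definition metric_in n (M : manifold 'rV[R]_n) (g : M -> 'M[R]_n)
    (c : chart 'rV[R]_n M) (y : 'rV[R]_n) : 'M[R]_n :=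
  let x := cinv c y in
  let A := jacobian (chart_at x \o cinv c) y in
  A *m g x *m A^T.

Definition inner n (A : 'M[R]_n) (v w : 'rV[R]_n) : R :=
  (v *m A *m w^T) 0 0.

Definition inner_products n (M : manifold 'rV[R]_n) (g : M -> 'M[R]_n) :=
  forall x, (g x)^T = g x /\ forall v, v != 0 -> 0 < inner (g x) v v.

Definition C1_metric n (M : manifold 'rV[R]_n) (g : M -> 'M[R]_n) : Prop :=
  inner_products g /\
  forall c, atlas c -> Cn 1 (ctgt c) (metric_in g c).

Definition smooth_metric n (M : manifold 'rV[R]_n) (g : M -> 'M[R]_n) : Prop :=
  inner_products g /\
  forall c, atlas c -> smooth (ctgt c) (metric_in g c).

Definition invariant_metric d n (G : lie_group d) (M : manifold 'rV[R]_n)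
    (act : G -> M -> M) (g : M -> 'M[R]_n) : Prop :=
  forall a x, let A := tmat (act a) x in A *m g (act a x) *m A^T = g x.

(* Christoffel symbol [Gamma^k_ij] of the coordinate metric [h]. *)
Definition christoffel n (h : 'rV[R]_n -> 'M[R]_n) (y : 'rV[R]_n)
    (k i j : 'I_n) : R :=
  2^-1 * \sum_l invmx (h y) k l *
    ('D_(basis i) (fun z => h z j l) y + 'D_(basis j) (fun z => h z i l) y
     - 'D_(basis l) (fun z => h z i j) y).

Definition ricci n (h : 'rV[R]_n -> 'M[R]_n) (y : 'rV[R]_n)
    (i j : 'I_n) : R :=
  \sum_k ('D_(basis k) (fun z => christoffel h z k i j) y
          - 'D_(basis j) (fun z => christoffel h z k i k) y
          + \sum_l (christoffel h y k k l * christoffel h y l i j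
                    - christoffel h y k j l * christoffel h y l i k)).

Definition einstein n (M : manifold 'rV[R]_n) (lambda : R)
    (g : M -> 'M[R]_n) : Prop :=
  forall c y i j, atlas c -> ctgt c y ->
    ricci (metric_in g c) y i j = lambda * metric_in g c y i j.

Definition smooth_curve n (M : manifold 'rV[R]_n) (c : R -> M) : Prop :=
  smooth_on setT (c : model R -> M).

Definition velocity n (M : manifold 'rV[R]_n) (c : R -> M) (t : R)
    : 'rV[R]_n :=
  derive1 (chart_at (c t) \o c) t.

(* [W] is a vector field along [c] whose covariant derivative vanishes at
   the times in [D]. *)
Definition parallel_on n (M : manifold 'rV[R]_n) (g : M -> 'M[R]_n)
    (D : set R) (c : R -> M) (W : R -> 'rV[R]_n) : Prop :=
  forall t d, D t -> atlas d -> cdom d (c t) ->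
    let w := fun s => tcoord d (c s) (W s) in
    derivable w t 1 /\
    derive1 w t + \row_k (\sum_i \sum_j
      christoffel (metric_in g d) (d (c t)) k i j
      * derive1 (d \o c) t 0 i * w t 0 j) = 0.

Definition geodesic_on n (M : manifold 'rV[R]_n) (g : M -> 'M[R]_n)
    (D : set R) (c : R -> M) : Prop :=
  smooth_curve c /\ parallel_on g D c (velocity c).

(* [y'] is the image of [v], a tangent vector at [y], under the exponential
   map. *)
Definition exp_rel n (N : manifold 'rV[R]_n) (h : N -> 'M[R]_n) (y : N)
    (v : 'rV[R]_n) (y' : N) : Prop :=
  exists c : R -> N,
    [/\ geodesic_on h setT c, c 0 = y, velocity c 0 = v & c 1 = y'].

(* [gamma] restricted to [0, L] is, for the metric [g], a unit-speed geodesic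
   orthogonal to the orbits, running from one endpoint orbit to the other. *)
Definition normal_geodesic d n (G : lie_group d) (M : manifold 'rV[R]_n)
    (act : G -> M -> M) (q : M -> R) (L : R) (gamma : R -> M)
    (g : M -> 'M[R]_n) : Prop :=
  [/\ geodesic_on g [set t | 0 <= t <= L] gamma,
      forall t, 0 <= t <= L ->
        inner (g (gamma t)) (velocity gamma t) (velocity gamma t) = 1,
      forall t, 0 <= t <= L ->
        velocity gamma t *m g (gamma t) *m (orbit_mx act (gamma t))^T = 0,
      q (gamma 0) = 0 /\ q (gamma L) = 1
    & forall t, 0 < t < L -> 0 < q (gamma t) < 1].

(* A single [gamma] serves all metrics: this is the normalization. *)
Definition normalized_metric d n (G : lie_group d) (M : manifold 'rV[R]_n)
    (act : G -> M -> M) (q : M -> R) (L : R) (gamma : R -> M)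
    (g : M -> 'M[R]_n) : Prop :=
  [/\ C1_metric g, invariant_metric act g
    & normal_geodesic act q L gamma g].

(* [tension g h f x] is a tangent vector of [N] at [f x]. *)
Definition tension m n (M : manifold 'rV[R]_m) (N : manifold 'rV[R]_n)
    (g : M -> 'M[R]_m) (h : N -> 'M[R]_n) (f : M -> N) (x : M) : 'rV[R]_n :=
  let c := chart_at x in
  let d := chart_at (f x) in
  let u := d \o f \o cinv c in
  let y := c x in
  let P i z := 'D_(basis i) u z in
  \row_k \sum_i \sum_j invmx (metric_in g c y) i j *
    ('D_(basis i) (P j) y 0 k
     - \sum_l christoffel (metric_in g c) y l i j * P l y 0 k
     + \sum_a \sum_b christoffel (metric_in h d) (u y) k a b
                     * P i y 0 a * P j y 0 b).

Fixpoint holder m n (k : nat) (alpha : R) (O : set 'rV[R]_m)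
    (u : 'rV[R]_m -> 'rV[R]_n) : Prop :=
  match k with
  | 0 => forall y, O y -> exists2 e, 0 < e & exists C, forall z w,
           O z -> O w -> `|z - y| < e -> `|w - y| < e ->
           `|u z - u w| <= C * `|z - w| `^ alpha
  | k'.+1 => (forall y, O y -> differentiable u y) /\
      forall i, holder k' alpha O (fun y => 'D_(basis i) u y)
  end.

(* Bound by [B] on the sup norms over [K] of the derivatives of order at most
   [k] and on the Hoelder seminorms of those of order [k]. *)
Fixpoint holder_bound m n (k : nat) (alpha : R) (K : set 'rV[R]_m) (B : R)
    (u : 'rV[R]_m -> 'rV[R]_n) : Prop :=
  (forall y, K y -> `|u y| <= B) /\
  match k with
  | 0 => forall y z, K y -> K z -> `|u y - u z| <= B * `|y - z| `^ alpha
  | k'.+1 =>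
      forall i, holder_bound k' alpha K B (fun y => 'D_(basis i) u y)
  end.

Definition holder_map m n (M : manifold 'rV[R]_m) (N : manifold 'rV[R]_n)
    (k : nat) (alpha : R) (f : M -> N) : Prop :=
  continuous f /\
  forall c d, atlas c -> atlas d ->
    holder k alpha (c @` [set x | cdom c x /\ cdom d (f x)])
           (d \o f \o cinv c).

(* A section [s] of the pull-back of [TN] by [f] assigns to [x] a tangent
   vector of [N] at [f x]; [section_in f s c d] is its local expression. *)
Definition section_in m n (M : manifold 'rV[R]_m) (N : manifold 'rV[R]_n)
    (f : M -> N) (s : M -> 'rV[R]_n) (c : chart 'rV[R]_m M)
    (d : chart 'rV[R]_n N) (y : 'rV[R]_m) : 'rV[R]_n :=
  tcoord d (f (cinv c y)) (s (cinv c y)).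

Definition holder_section m n (M : manifold 'rV[R]_m) (N : manifold 'rV[R]_n)
    (k : nat) (alpha : R) (f : M -> N) (s : M -> 'rV[R]_n) : Prop :=
  forall c d, atlas c -> atlas d ->
    holder k alpha (c @` [set x | cdom c x /\ cdom d (f x)])
           (section_in f s c d).

Definition equivariant_section d m n (G : lie_group d)
    (M : manifold 'rV[R]_m) (N : manifold 'rV[R]_n) (actM : G -> M -> M)
    (actN : G -> N -> N) (f : M -> N) (s : M -> 'rV[R]_n) : Prop :=
  forall a x, s (actM a x) = s x *m tmat (actN a) (f x).

(* [Y], via the injection [ev], is the Banach space of those [C^(k,alpha)]
   sections of the pull-back of [TN] by [f] that satisfy [P]: its norm is
   equivalent to the Hoelder norm computed in finitely many charts. *)
Definition section_space m n (M : manifold 'rV[R]_m) (N : manifold 'rV[R]_n)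
    (k : nat) (alpha : R) (f : M -> N) (P : set (M -> 'rV[R]_n))
    (Y : completeNormedModType R) (ev : Y -> M -> 'rV[R]_n) : Prop :=
  [/\ forall (a : R) (s t : Y) x, ev (a *: s + t) x = a *: ev s x + ev t x,
      injective ev,
      range ev = [set s | holder_section k alpha f s /\ P s]
    & exists (r : nat) (c : 'I_r -> chart 'rV[R]_m M)
        (d : 'I_r -> chart 'rV[R]_n N) (K : 'I_r -> set M),
      [/\ forall j, [/\ atlas (c j), atlas (d j), compact (K j),
                       K j `<=` cdom (c j) & f @` K j `<=` cdom (d j)],
          forall x, exists j, interior (K j) x
        & exists2 C, 0 < C & forall s : Y,
            (forall j, holder_bound k alpha (c j @` K j) (C * `|s|)
                         (section_in f (ev s) (c j) (d j))) /\
            forall B, 0 <= B ->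
              (forall j, holder_bound k alpha (c j @` K j) B
                           (section_in f (ev s) (c j) (d j))) ->
              `|s| <= C * B]].

Definition equivariant_homotopic d m n (G : lie_group d)
    (M : manifold 'rV[R]_m) (N : manifold 'rV[R]_n) (actM : G -> M -> M)
    (actN : G -> N -> N) (f f' : M -> N) : Prop :=
  exists Ht : R -> M -> N,
    [/\ {within [set z : R * M | 0 <= z.1 <= 1],
           continuous (fun z => Ht z.1 z.2)},
        Ht 0 = f, Ht 1 = f'
      & forall t, 0 <= t <= 1 -> equivariant actM actN (Ht t)].

End finite_dim.

(* The Banach manifold [B], whose points are maps through [ev], is the set
   [P] of [C^(k,alpha)] maps with the structure of a (split) submanifold of
   the space of all [C^(k,alpha)] maps from [M] to [N].  The charts of the
   latter at [f] are [xi |-> exp_f xi], with [xi] in the Banach space of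
   [C^(k,alpha)] sections of the pull-back of [TN] by [f].  In these charts
   the inclusion [L] of [B] must be smooth, be a split immersion at [f], and
   be a topological embedding. *)
Definition mapping_submanifold (R : realType) (E : completeNormedModType R)
    m n (M : manifold 'rV[R]_m) (N : manifold 'rV[R]_n) (h : N -> 'M[R]_n)
    (k : nat) (alpha : R) (P : set (M -> N)) (B : manifold E)
    (ev : B -> M -> N) : Prop :=
  [/\ injective ev, range ev = P, P `<=` [set f | holder_map k alpha f]
    & forall f : B, exists (X : completeNormedModType R)
        (evX : X -> M -> 'rV[R]_n) (W : set B) (L : B -> model X),
      [/\ section_space k alpha (ev f) setT evX,
          [/\ open_nbhs f W, smooth_on W L, L f = 0
            & forall f', W f' ->
                forall x, exp_rel h (ev f x) (evX (L f') x) (ev f' x)],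
          exists2 r : {linear X -> E}, continuous r
            & forall v : E, r (mdiff L f v) = v
        & forall W', nbhs f W' -> exists2 e, 0 < e &
            forall (xi : X) (f' : B), `|xi| < e ->
              (forall x, exp_rel h (ev f x) (evX xi x) (ev f' x)) -> W' f']].

(* Smooth vector bundles with Banach fibres.  The local trivialization
   centred at [b] is defined over [tdom b] and takes values in the fibre over
   [b] itself. *)
Record banach_bundle (R : realType) (E : normedModType R) (B : manifold E) :=
  BanachBundle {
    fib :> B -> completeNormedModType R;
    tdom : B -> set B;
    triv : forall b b', fib b' -> fib b;
    triv_inv : forall b b', fib b -> fib b';
    tdom_nbhs : forall b, open_nbhs b (tdom b);
    triv_linear : forall b b', tdom b b' -> linear (@triv b b');
    triv_cont : forall b b', tdom b b' -> continuous (@triv b b');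
    triv_inv_cont : forall b b', tdom b b' -> continuous (@triv_inv b b');
    trivK : forall b b', tdom b b' -> cancel (@triv b b') (@triv_inv b b');
    triv_invK : forall b b', tdom b b' -> cancel (@triv_inv b b') (@triv b b');
    triv_id : forall b s, @triv b b s = s;
    triv_smooth : forall b1 b2,
      smooth2_on ((tdom b1 `&` tdom b2) `*` setT)
        ((fun b' s => triv b2 (triv_inv b' s))
           : B -> model (fib b1) -> model (fib b2))
  }.

(* The bundle over [B] with fibre at [f] the equivariant [C^(k,alpha)]
   sections of the pull-back of [TN] by [f].  Close to its centre [f], the
   trivialization is pointwise parallel transport along the short geodesics
   from [f x] to [f' x]. *)
Definition section_bundle (R : realType) (E : normedModType R) d m n
    (G : lie_group R d) (M : manifold 'rV[R]_m) (N : manifold 'rV[R]_n)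
    (actM : G -> M -> M) (actN : G -> N -> N) (h : N -> 'M[R]_n)
    (k : nat) (alpha : R) (B : manifold E) (ev : B -> M -> N)
    (Y : banach_bundle B) (evY : forall f, Y f -> M -> 'rV[R]_n) : Prop :=
  (forall f, section_space k alpha (ev f)
               [set s | equivariant_section actM actN (ev f) s] (@evY f)) /\
  forall (f : B) (e : R), 0 < e -> exists2 W, nbhs f W &
    forall f', W f' -> tdom Y f f' /\ forall (s : Y f') x,
      exists (c : R -> N) (w : R -> 'rV[R]_n),
        [/\ [/\ geodesic_on h setT c, c 0 = ev f x & c 1 = ev f' x],
            inner (h (ev f x)) (velocity c 0) (velocity c 0) < e,
            parallel_on h setT c w, w 1 = evY f' s x
          & w 0 = evY f (triv f s) x].

(* Main.v *)
Require Import Defs.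
From HB Require Import structures.
From mathcomp Require Import all_boot all_order all_algebra.
From mathcomp Require Import all_classical all_reals all_analysis.
From mathcomp Require Import lra.

Set Implicit Arguments.
Unset Strict Implicit.
Unset Printing Implicit Defensive.

Import Order.TTheory GRing.Theory Num.Theory.
Import numFieldNormedType.Exports.

Local Open Scope classical_set_scope.
Local Open Scope ring_scope.

(** Newton's map [y |-> y - T^-1 (f (x, y))], with [T] the partial derivative of
    [f] in [y] at the base point, contracts a ball around [y0] uniformly in [x]
    near [x0]; its fixed points are the zeros of [f], and this gives the local
    solution [u], its uniqueness and its continuity.  Smoothness of [u] is proved
    without operator-valued maps: [(u x, du_x v)] solves the tangent equation
    [f (x, y) = 0, df_(x, y) (v, w) = 0], which is again smooth and whose partial
    derivative in [(y, w)] is block triangular with the invertible diagonal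
    blocks [D_y f], so that one induction on [n] shows [u] to be [C^n] for all
    [n].  The theorem is this statement read in the charts at [g0] and [f0] and
    in the trivialization at [f0]. *)

(** * Estimates from the differential and the mean value inequality *)

Section differential_estimates.
Context (R : realType).
Implicit Types E F G : normedModType R.

Lemma diff_near E F (f : E -> F) (x : E) : differentiable f x ->
  forall e, 0 < e -> \forall y \near x,
    `|f y - f x - 'd f x (y - x)| <= e * `|y - x|.
Proof.
move=> /diff_locallyP [_ /eqaddoP fx] e e0.
rewrite (near_shift 0 x); have := fx _ e0 => fx'.
near=> y; rewrite /= subr0 addrK -addrA -opprD.
by near: y.
Unshelve. all: by end_near. Qed.

Lemma near_is_diff E F (f : E -> F) (x : E) (df : {linear E -> F}) :
  continuous df ->
  (forall e, 0 < e -> \forall y \near x,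
    `|f y - f x - df (y - x)| <= e * `|y - x|) ->
  is_diff x f df.
Proof.
move=> cdf fx.
have fE : f \o shift x = cst (f x) + df +o_ 0 id.
  apply/eqaddoP => e e0; have := fx _ e0.
  rewrite (near_shift 0 x); apply: filterS => y /=.
  by rewrite subr0 addrK !fctE opprD addrA.
have dE := diff_unique cdf fE.
by apply: DiffDef => //; apply/diff_locallyP; rewrite dE.
Qed.

Lemma diff_lipschitz E F (f : E -> F) (x : E) : differentiable f x ->
  forall C, (forall v, `|'d f x v| <= C * `|v|) ->
  forall e, 0 < e -> \forall y \near x, `|f y - f x| <= (C + e) * `|y - x|.
Proof.
move=> dfx C dC e e0; near=> y.
rewrite -[f y - f x](subrK ('d f x (y - x))) mulrDl addrC.
apply: (le_trans (ler_normD _ _)); apply: lerD => //.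
by near: y; exact: diff_near.
Unshelve. all: by end_near. Qed.

(* The supremum of the times up to which the bound holds is attained and is 1;
   this covers arbitrary normed targets without dual functionals. *)
Lemma mean_value_interval F (g : R -> F) (K : R) :
  (forall t : R, 0 <= t <= 1 -> \forall s \near t, `|g s - g t| <= K * `|s - t|) ->
  `|g 1 - g 0| <= K.
Proof.
move=> gK; pose A := [set t : R | 0 <= t <= 1 /\ `|g t - g 0| <= K * t].
have A0 : A 0 by split; rewrite ?lexx ?ler01// subrr normr0 mulr0.
have supA : has_sup A by split; [exists 0|exists 1 => t [/andP[]]].
set s := sup A.
have s01 : 0 <= s <= 1.
  rewrite sup_upper_bound//= ge_sup//; first by exists 0.
  by move=> t [/andP[]].
have As : A s.
  split=> //; have /nbhs_ballP[e /= e0 sP] := gK _ s01.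
  (* A time of [A] within [e] of [s] hands its bound on to [s] through the local estimate at [s]. *)
  have [t At ts] := sup_adherent e0 supA.
  have le_ts : t <= s by exact: sup_upper_bound.
  have /sP : ball s e t.
    by rewrite -ball_normE /= ger0_norm ?subr_ge0// ltrBlDl -ltrBlDr.
  rewrite distrC (distrC t) (ger0_norm (x := s - t)) ?subr_ge0// => st.
  case: At => _ At; rewrite -[s in leRHS](subrK t) mulrDr.
  by apply: (le_trans (ler_distD (g t) _ _)); exact: lerD.
have [s1|s1] := ltP s 1; last first.
  have s1' : s = 1 by apply/eqP; rewrite eq_le s1; case/andP: s01 => _ ->.
  by case: As; rewrite s1' mulr1.
have /nbhs_ballP[e /= e0 sP] := gK _ s01.
(* Half of [e] keeps [t] in the ball around [s] and the cap [1 - s] keeps [t <= 1]; membership of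
   [t] in [A] then contradicts the supremum. *)
pose t := s + Num.min (e / 2) (1 - s).
have st : s < t by rewrite ltrDl lt_min divr_gt0//= subr_gt0.
have te : t < s + e.
  by rewrite ltrD2l gt_min; apply/orP; left; lra.
have t1 : t <= 1 by rewrite -lerBrDl ge_min lexx orbT.
suff /(sup_upper_bound supA) : A t by rewrite leNgt st.
split; first by rewrite t1 (le_trans _ (ltW st))//; case/andP: s01.
have /sP : ball s e t.
  by rewrite -ball_normE /= distrC ger0_norm ?subr_ge0 ?ltW// ltrBlDl.
rewrite (@ger0_norm _ (t - s)) ?subr_ge0; last exact: ltW.
move=> stK.
case: As => _ As; rewrite -[t in leRHS](subrK s) mulrDr.
by apply: (le_trans (ler_distD (g s) _ _)); exact: lerD.
Qed.

Lemma ball_segment E (c x y : E) (r t : R) : ball c r x -> ball c r y ->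
  0 <= t <= 1 -> ball c r (x + t *: (y - x)).
Proof.
rewrite -!ball_normE /= => cx cy /andP[t0 t1].
have -> : c - (x + t *: (y - x)) = (1 - t) *: (c - x) + t *: (c - y).
  rewrite scalerBl scale1r -addrA [- _ + _]addrC -scalerBr opprB.
  by rewrite [c - y + _]addrC subrKA -[x - y]opprB scalerN opprD addrA.
apply: (le_lt_trans (ler_normD _ _)); rewrite !normrZ.
rewrite !ger0_norm ?subr_ge0//.
(* The strict inequality is drawn from the term weighted by [t], so [t = 0] is treated apart. *)
have [->|tn0] := eqVneq t 0; first by rewrite mul0r addr0 subr0 mul1r.
have {}t0 : 0 < t by rewrite lt_def tn0.
rewrite -[ltRHS](_ : (1 - t) * r + t * r = _); last by rewrite -mulrDl subrK mul1r.
by apply: ler_ltD; [rewrite ler_wpM2l ?subr_ge0// ltW|rewrite ltr_pM2l].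
Qed.

Lemma mean_value_ball E F (f : E -> F) (c : E) (r K : R) :
  (forall z, ball c r z -> differentiable f z) ->
  (forall z, ball c r z -> forall v, `|'d f z v| <= K * `|v|) ->
  forall x y, ball c r x -> ball c r y -> `|f y - f x| <= K * `|y - x|.
Proof.
move=> df dfK x y cx cy; apply/ler_addgt0Pr => e e0.
(* The summand 1 keeps the denominator positive when [x = y]; the slack [e'] then costs at most [e]
   over the whole segment. *)
pose e' := e / (`|y - x| + 1).
have y1 : 0 < `|y - x| + 1 by rewrite ltr_wpDl.
have e'0 : 0 < e' by rewrite divr_gt0.
pose g t := f (x + t *: (y - x)).
have /(_ ((K + e') * `|y - x|)) := @mean_value_interval _ g.
rewrite [in g 1 - _]/g scale1r scale0r addr0 [x + _]addrC subrK => H.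
apply: (le_trans (H _)).
  move=> {H} t t01; have B := ball_segment cx cy t01.
  have dfB := diff_lipschitz (df _ B) (dfK _ B) e'0.
  have cvgt : (fun s : R => x + s *: (y - x)) @ t --> x + t *: (y - x).
    by apply: cvgD; [exact: cvg_cst|apply: cvgZr_tmp; exact: cvg_id].
  near=> s; rewrite /g; set ft := f (x + t *: _).
  have : `|f (x + s *: (y - x)) - ft| <=
      (K + e') * `|x + s *: (y - x) - (x + t *: (y - x))|.
    by near: s; exact: (cvgt _ dfB).
  by rewrite opprD addrACA subrr add0r -scalerBl normrZ [`|s - t| * _]mulrC mulrA.
rewrite mulrDl lerD2l mulrAC ler_pdivrMr// ler_pM2l//.
by rewrite lerDl.
Unshelve. all: by end_near. Qed.

End differential_estimates.

(** * Calculus of [Cn] maps *)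

Section Cn_calculus.
Context (R : realType).
Implicit Types (E F G : normedModType R) (n : nat).

(** Named so that it can carry the linear structure declared below. *)
Definition pair_fun E F G (f : E -> F) (g : E -> G) (x : E) := (f x, g x).

Lemma pair_fun_linear E F G (f : {linear E -> F}) (g : {linear E -> G}) :
  linear (pair_fun f g).
Proof. by move=> a x y; rewrite /pair_fun !linearP. Qed.

HB.instance Definition _ E F G (f : {linear E -> F}) (g : {linear E -> G}) :=
  GRing.isLinear.Build R E (F * G)%type *:%R (pair_fun f g)
    (pair_fun_linear f g).

Lemma continuous_fst E F : continuous (@fst E F).
Proof. by move=> x; exact: cvg_fst. Qed.

Lemma continuous_snd E F : continuous (@snd E F).
Proof. by move=> x; exact: cvg_snd. Qed.

Lemma pair_fun_continuous E F G (f : E -> F) (g : E -> G) :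
  continuous f -> continuous g -> continuous (pair_fun f g).
Proof. by move=> cf cg x; apply: cvg_pair; [exact: cf|exact: cg]. Qed.

Lemma near_eq_is_diff E F (f g : E -> F) (x : E) :
  (\forall y \near x, f y = g y) -> differentiable f x -> is_diff x g ('d f x).
Proof.
move=> fg df; apply: near_is_diff => [|e e0]; first exact: diff_continuous.
near=> y; rewrite -(nbhs_singleton fg) -(near fg y)//.
by near: y; exact: diff_near.
Unshelve. all: by end_near. Qed.

Lemma Cn_sub n E F (U V : set E) (f : E -> F) :
  V `<=` U -> Cn n U f -> Cn n V f.
Proof.
elim: n E F U V f => [|n IH] E F U V f VU /=; first by move=> cf x /VU; exact: cf.
move=> [df Cf]; split; first by move=> x /VU; exact: df.
by apply: IH Cf => x []/VU.
Qed.

Lemma CnW n E F (U : set E) (f : E -> F) : Cn n.+1 U f -> Cn n U f.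
Proof.
elim: n E F U f => [|n IH] E F U f [df Cf].
  by move=> x /df/differentiable_continuous.
by split => //; exact: IH.
Qed.

Lemma openX_setT E F (U : set E) : open U -> open (U `*` @setT F).
Proof.
move=> oU; rewrite (_ : _ `*` _ = fst @^-1` U).
  by apply: open_comp => // x _; exact: continuous_fst.
by apply/seteqP; split => [x []|].
Qed.

Lemma eq_Cn n E F (U : set E) (f g : E -> F) :
  open U -> (forall x, U x -> f x = g x) -> Cn n U f -> Cn n U g.
Proof.
elim: n E F U f g => [|n IH] E F U f g oU fg.
  move=> cf x Ux; have Un := open_nbhs_nbhs (conj oU Ux).
  rewrite /prop_for /continuous_at -fg//; apply: cvg_trans (cf x Ux).
  by apply: near_eq_cvg; near=> y; apply: fg; near: y.
move=> [df Cf]; have dg x : U x -> is_diff x g ('d f x).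
  move=> Ux; have Un := open_nbhs_nbhs (conj oU Ux).
  by apply: near_eq_is_diff; [near=> y; apply: fg; near: y|exact: df].
split; first by move=> x /dg[].
apply: IH Cf; first exact: openX_setT.
by move=> [x v] [/= /dg dgx _]; rewrite [in RHS]diff_val.
Unshelve. all: by end_near. Qed.

(** The derivative of [f \o A] is that of [f] with [A] applied to both point and vector, again a
    linear substitution. This case precedes the chain rule, whose induction step substitutes
    [fst]. *)
Lemma Cn_comp_linear n E E' F (U : set E) (f : E -> F) (A : {linear E' -> E}) :
  open U -> continuous A -> Cn n U f -> Cn n (A @^-1` U) (f \o A).
Proof.
elim: n E E' F U f A => [|n IH] E E' F U f A oU cA.
  by move=> cf x Ux; apply: continuous_comp; [exact: cA|exact: cf].
move=> [df Cf]; have dA x : differentiable A x by exact: linear_differentiable.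
split; first by move=> x Ux; apply: differentiable_comp => //; exact: df.
pose AA : {linear (E' * E')%type -> (E * E)%type} :=
  pair_fun (A \o fst) (A \o snd).
have cAA : continuous AA.
  apply: pair_fun_continuous => x; apply: continuous_comp; try exact: cA.
    exact: continuous_fst.
  exact: continuous_snd.
have := IH _ _ _ _ _ AA (openX_setT oU) cAA Cf.
apply: eq_Cn; first by apply: open_comp => [x _|]; [exact: cAA|exact: openX_setT].
move=> [x v] [/= Ux _].
by rewrite (diff_comp (dA x) (df _ Ux)) /= diff_lin.
Qed.

Lemma Cn_linear_comp n E F G (U : set E) (f : E -> F) (A : {linear F -> G}) :
  open U -> continuous A -> Cn n U f -> Cn n U (A \o f).
Proof.
elim: n E F G U f A => [|n IH] E F G U f A oU cA.
  by move=> cf x Ux; apply: continuous_comp; [exact: cf|exact: cA].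
move=> [df Cf]; have dA x : differentiable A x by exact: linear_differentiable.
split; first by move=> x Ux; apply: differentiable_comp => //; exact: df.
have := IH _ _ _ _ _ A (openX_setT oU) cA Cf.
apply: eq_Cn; first exact: openX_setT.
move=> [x v] [/= Ux _].
by rewrite (diff_comp (df _ Ux) (dA _)) /= diff_lin.
Qed.

Lemma Cn_pair n E F G (U : set E) (f : E -> F) (g : E -> G) :
  open U -> Cn n U f -> Cn n U g -> Cn n U (pair_fun f g).
Proof.
elim: n E F G U f g => [|n IH] E F G U f g oU.
  by move=> cf cg x Ux; apply: cvg_pair; [exact: cf|exact: cg].
move=> [df Cf] [dg Cg].
split; first by move=> x Ux; apply: differentiable_pair; [exact: df|exact: dg].
have := IH _ _ _ _ _ _ (openX_setT oU) Cf Cg.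
apply: eq_Cn; first exact: openX_setT.
by move=> [x v] [/= Ux _]; rewrite (diff_pair (df _ Ux) (dg _ Ux)).
Qed.

(** The derivative of [g \o f] is that of [g] composed with the pair of [f \o fst] and the
    derivative of [f]; both components are [Cn n], so the induction hypothesis applies. *)
Lemma Cn_comp n E F G (U : set E) (V : set F) (f : E -> F) (g : F -> G) :
  open U -> open V -> (forall x, U x -> V (f x)) ->
  Cn n U f -> Cn n V g -> Cn n U (g \o f).
Proof.
elim: n E F G U V f g => [|n IH] E F G U V f g oU oV UV.
  by move=> cf cg x Ux; apply: continuous_comp; [exact: cf|exact/cg/UV].
move=> Cf [dg Cg]; have Cf' := CnW Cf; have [df Tf] := Cf.
split.
  by move=> x Ux; apply: differentiable_comp; [exact: df|exact/dg/UV].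
have oUT : open (U `*` @setT E) by exact: openX_setT.
have Cfst : Cn n (U `*` @setT E) (f \o fst).
  have := Cn_comp_linear oU (@continuous_fst E E) Cf'.
  by apply: Cn_sub => x [].
have := IH _ _ _ _ _ _ _ oUT (openX_setT oV) _ (Cn_pair oUT Cfst Tf) Cg.
move=> /(_ _)/(eq_Cn oUT) H; apply: H => [[x v]|[x v]] [/= Ux _].
  by rewrite (diff_comp (df _ Ux) (dg _ (UV _ Ux))).
by split=> //; exact: UV.
Qed.

End Cn_calculus.

(** * Partial derivatives and the differential of the tangent map *)

Section partial_derivatives.
Context (R : realType).
Implicit Types (E F G : normedModType R).

(** The vector part of the usual tangent map, and the function to which [Cn] recurs. *)
Definition tangent_map E F (f : E -> F) (p : E * E) : F := 'd f (p.1) (p.2).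

Lemma is_diffE E F (f df : E -> F) (x v : E) : is_diff x f df -> 'd f x v = df v.
Proof. by move=> H; rewrite diff_val. Qed.

Lemma is_diff_partial1 E F G (f : E * F -> G) (z : E * F) : differentiable f z ->
  is_diff (z.1) (fun x => f (x, z.2)) (fun v => 'd f z (v, 0)).
Proof.
case: z => x y df /=.
have dp : is_diff x (fun t => (t, y)) (fun v => (v, 0)).
  exact: (@is_diff_pair _ _ _ _ id id (cst y) 0 x).
exact: (is_diff_comp dp (differentiableP df)).
Qed.

Lemma is_diff_partial2 E F G (f : E * F -> G) (z : E * F) : differentiable f z ->
  is_diff (z.2) (fun y => f (z.1, y)) (fun w => 'd f z (0, w)).
Proof.
case: z => x y df /=.
have dp : is_diff y (fun t => (x, t)) (fun v => (0, v)).
  exact: (@is_diff_pair _ _ _ _ (cst x) 0 id id y).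
exact: (is_diff_comp dp (differentiableP df)).
Qed.

(** At a fixed base point [tangent_map f] is linear and continuous, hence its own derivative. *)
Lemma diff_tangent_fiber E F (f : E -> F) (z v w : E) :
  differentiable f z ->
  differentiable (tangent_map f) (z, v) ->
  'd (tangent_map f) (z, v) (0, w) = 'd f z w.
Proof.
move=> df /is_diff_partial2/(is_diffE w)/= <-.
have cdf : continuous ('d f z) by exact: diff_continuous.
exact: (congr1 (@^~ w) (diff_lin v cdf)).
Qed.

(** On the zero section [tangent_map f] vanishes, so moving the base point along it contributes
    nothing. *)
Lemma diff_tangent0 E F (f : E -> F) (z v w : E) :
  differentiable f z ->
  differentiable (tangent_map f) (z, 0) ->
  'd (tangent_map f) (z, 0) (v, w) = 'd f z w.
Proof.
move=> df dT.
rewrite [(v, w)](_ : _ = (v, 0) + (0, w)); last first.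
  by congr (_, _); rewrite ?addr0 ?add0r.
rewrite linearD diff_tangent_fiber//.
have /(is_diffE v)/= <- := is_diff_partial1 dT.
rewrite (_ : (fun _ => _) = cst 0) ?diff_cst ?add0r//.
by apply/funext => x; rewrite /tangent_map linear0.
Qed.

(* [C^2] in the sense of [Cn] makes the differential continuous in operator norm:
   differentiability of [(z, v) |-> df_z v] at [(z0, 0)], tested on vectors [v]
   as long as the distance from [z] to [z0], is a bound relative to [|v|]. *)
Lemma diff_near_diff E F (U : set E) (f : E -> F) (z0 : E) :
  Cn 2 U f -> U z0 -> forall e, 0 < e ->
  \forall z \near z0, forall v, `|'d f z v - 'd f z0 v| <= e * `|v|.
Proof.
move=> [df [dT _]] Uz e e0.
have dT0 : differentiable (tangent_map f) (z0, 0) by exact: dT.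
have /nbhs_ballP[d /= d0 dP] := diff_near dT0 e0.
apply/nbhs_ballP; exists (d / 2); first by rewrite /= divr_gt0.
move=> z zz v; have [->|v0] := eqVneq v 0.
  have d0E t : 'd f t 0 = 0 by exact: linear0.
  by rewrite !d0E subrr !normr0 mulr0.
have nv : 0 < `|v| by rewrite normr_gt0.
(* Rescaling [v] to length [d / 2], at least the distance from [z] to [z0], makes the product norm
   equal to that length; the factor [a] then cancels on both sides. *)
pose a := d / 2 / `|v|; have a0 : 0 < a by rewrite !divr_gt0.
have nav : `|a *: v| = d / 2.
  by rewrite normrZ gtr0_norm// divfK ?gt_eqF.
have d2 : d / 2 < d by rewrite ltr_pdivrMr// ltr_pMr// ltr1n.
have /dP/= : ball (z0, 0) d (z, a *: v).
  split; first exact: le_ball (ltW d2) _ zz.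
  by rewrite -ball_normE /= sub0r normrN nav.
have -> : (z, a *: v) - (z0, 0) = (z - z0, a *: v) by congr (_, _); rewrite subr0.
rewrite diff_tangent0//; last exact: df.
have d0E : 'd f z0 0 = 0 by exact: linear0.
have daE t : 'd f t (a *: v) = a *: 'd f t v by exact: linearZ.
rewrite /tangent_map/= d0E subr0 !daE -scalerBr normrZ prod_normE/= nav.
have -> : Num.max `|z - z0| (d / 2) = a * `|v|.
  rewrite divfK ?gt_eqF//; apply/max_idPr.
  by move: zz; rewrite -ball_normE /= distrC => /ltW.
by rewrite gtr0_norm// mulrCA ler_pM2l.
Qed.

End partial_derivatives.

(** * Fixed points of contractions and perturbation of isomorphisms *)

Section linear_isomorphisms.
Context (R : realType).

(** The closed ball is mapped into itself: [N y] is within [r / 2] of [N y0], which is within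
    [r / 2] of [y0]. Banach's theorem then applies. *)
Lemma contraction_fixed_point (F : completeNormedModType R) (N : F -> F)
    (y0 : F) (r : R) :
  0 <= r ->
  (forall y y', `|y - y0| <= r -> `|y' - y0| <= r ->
    `|N y - N y'| <= 2^-1 * `|y - y'|) ->
  `|N y0 - y0| <= r / 2 ->
  exists2 y, `|y - y0| <= r & N y = y.
Proof.
move=> r0 cN Ny0; pose B := [set y | `|y - y0| <= r].
have By0 : B y0 by rewrite /B/= subrr normr0.
have funN : isFun _ _ B B N.
  split=> y By; rewrite /B/= (le_trans (ler_distD (N y0) _ _))//.
  rewrite [leRHS]splitr lerD//; apply: (le_trans (cN _ _ By By0)).
  by rewrite mulrC ler_pM2r// invr_gt0.
pose NB : {fun B >-> B} := HB.pack N funN.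
have cNB : is_contraction NB.
  exists (2^-1)%:nng; split => /=; first by rewrite invf_lt1// ltr1n.
  by move=> [y y'] [By By'] /=; exact: cN.
have clB : closed B.
  rewrite (_ : B = closed_ball_ Num.norm y0 r); first exact: closed_closed_ball_.
  by apply/seteqP; split=> y; rewrite /B /closed_ball_/= distrC.
have [y By yN] := banach_fixed_point cNB clB (ex_intro _ _ By0).
by exists y => //; exact/esym.
Qed.

Lemma bounded_iso_inverse (F G : normedModType R) (T : {linear F -> G}) :
  bounded_iso T -> exists (T' : {linear G -> F}) (K : R),
    [/\ cancel T T', cancel T' T, continuous T', 0 < K &
        forall y, `|T' y| <= K * `|y|].
Proof.
move=> [cT [T' [TK T'K cT']]].
have lT' : linear T' by exact: (can2_linear TK T'K).
pose T'lin := GRing.isLinear.Build _ _ _ _ _ lT'.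
pose L : {linear G -> F} := HB.pack T' T'lin.
have [K K0 T'b] := @linear_lipschitz _ _ _ L cT'.
by exists L, K.
Qed.

(** Since [T' \o (T - S)] shrinks norms by half, the norm of [x] is at most [2 * K] times that of
    [S x], which gives injectivity and a bounded inverse; surjectivity is a fixed point of Newton's
    map for [S x = b]. *)
Lemma bounded_iso_perturbation (F : completeNormedModType R)
    (G : normedModType R) (T S : {linear F -> G}) (T' : {linear G -> F})
    (K : R) :
  0 < K -> cancel T T' -> cancel T' T -> (forall y, `|T' y| <= K * `|y|) ->
  continuous S -> (forall x, `|T x - S x| <= (2 * K)^-1 * `|x|) ->
  bounded_iso S.
Proof.
move=> K0 TK T'K T'b cS TS.
have T'B u v : T' (u - v) = T' u - T' v by exact: linearB.
have half (x : F) : `|T' (T x - S x)| <= 2^-1 * `|x|.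
  by rewrite (le_trans (T'b _))// -(ler_pdivlMl _ _ K0) mulrA -invfM [K * 2]mulrC.
have Sb (x : F) : `|x| <= 2 * K * `|S x|.
  have : `|x| <= K * `|S x| + 2^-1 * `|x|.
    rewrite -{1}[x]TK -[T x](subrK (S x)) linearD addrC.
    by rewrite (le_trans (ler_normD _ _))// lerD.
  by rewrite -mulrA; move: (K * _) `|x| => a b ?; lra.
have Ssurj b : exists x, S x = b.
  pose N x := x - T' (S x - b).
  (* As [N 0 = T' b], a radius of twice its norm is exactly what the fixed-point lemma asks for. *)
  have [|||x _ Nx] := @contraction_fixed_point F N 0 (2 * `|T' b|).
  - by rewrite mulr_ge0.
  - move=> y y' _ _; rewrite /N.
    suff -> : y - T' (S y - b) - (y' - T' (S y' - b)) =
        T' (T (y - y') - S (y - y')) by exact: half.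
    by rewrite opprD addrACA -opprD -T'B opprB addrA subrK -linearB/= T'B TK.
  - rewrite /N [S 0]linear0 T'B [T' 0]linear0 !sub0r opprK subr0.
    by rewrite mulrAC divff// mul1r.
  exists x; apply/eqP; rewrite -subr_eq0 -[_ - b]T'K.
  move: Nx => /eqP; rewrite /N subr_eq addrC -subr_eq subrr eq_sym => /eqP ->.
  by rewrite linear0.
have [S' SK'] := choice Ssurj.
have SK : cancel S S'.
  move=> x; apply/eqP; rewrite -subr_eq0 -normr_le0 (le_trans (Sb _))//.
  by rewrite linearB/= SK' subrr normr0 mulr0.
split => //; exists S'; split => //.
have lS' : linear S' by exact: (can2_linear SK SK').
pose S'lin := GRing.isLinear.Build _ _ _ _ _ lS'.
pose L : {linear G -> F} := HB.pack S' S'lin.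
apply: (@bounded_linear_continuous _ _ _ L).
apply/linear_boundedP; near=> M.
move=> y; rewrite (le_trans (Sb _))// SK' ler_wpM2r//.
Unshelve. all: by end_near. Qed.

End linear_isomorphisms.

(** * Existence, uniqueness and continuity of the implicit function *)

Section implicit_function.
Context (R : realType).
Implicit Types (E F G : normedModType R).

Definition partial2 E F G (f : E * F -> G) (z : E * F) (w : F) : G :=
  'd f z (0, w).

Lemma partial2_linear E F G (f : E * F -> G) (z : E * F) : linear (partial2 f z).
Proof.
move=> a u v; rewrite /partial2 -linearP; congr ('d f z _).
by rewrite -[RHS]/(a *: 0 + 0, a *: u + v) scaler0 addr0.
Qed.

HB.instance Definition _ E F G (f : E * F -> G) (z : E * F) :=
  GRing.isLinear.Build R F G *:%R (partial2 f z) (partial2_linear f z).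

Lemma partial2_continuous E F G (f : E * F -> G) (z : E * F) :
  differentiable f z -> continuous (partial2 f z).
Proof.
move=> df w; apply: (@continuous_comp _ _ _ (fun w => (0, w)) ('d f z)).
  by apply: cvg_pair; [exact: cvg_cst|exact: cvg_id].
exact: (diff_continuous df).
Qed.

Lemma norm_pair0 E F (w : F) : `|(0 : E, w)| = `|w|.
Proof. by rewrite prod_normE/= normr0; exact/max_idPr. Qed.

(** The last clause extends the isomorphism from the base point to the whole product of balls, so
    that differentiability can be proved at every point of the graph of [u]. *)
Lemma implicit_function E (F : completeNormedModType R) G (O : set (E * F))
    (f : E * F -> G) (x0 : E) (y0 : F) :
  open O -> Cn 2 O f -> O (x0, y0) -> f (x0, y0) = 0 ->
  bounded_iso (partial2 f (x0, y0)) ->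
  exists (d r : R) (u : E -> F),
    [/\ [/\ 0 < d, 0 < r & ball x0 d `*` ball y0 r `<=` O],
        forall x, ball x0 d x -> ball y0 r (u x) /\ f (x, u x) = 0,
        forall x y, ball x0 d x -> ball y0 r y -> f (x, y) = 0 -> y = u x,
        forall x, ball x0 d x -> {for x, continuous u} &
        forall x y, ball x0 d x -> ball y0 r y ->
          bounded_iso (partial2 f (x, y))].
Proof.
move=> oO Cf Oz fz isoT; have df := Cf.1.
have [T' [K [TK T'K cT' K0 T'b]]] := bounded_iso_inverse isoT.
have K20 : 0 < (2 * K)^-1 by rewrite invr_gt0 mulr_gt0.
have T'B u v : T' (u - v) = T' u - T' v by exact: linearB.
have nearO : \forall z \near (x0, y0), O z /\
    forall v, `|'d f z v - 'd f (x0, y0) v| <= (2 * K)^-1 * `|v|.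
  apply: filterI; first exact: open_nbhs_nbhs.
  exact: (diff_near_diff Cf).
have /nbhs_ballP[r /= r0 rP] := nearO.
have rO x y : ball x0 r x -> ball y0 r y -> O (x, y).
  by move=> xr yr; apply: (rP (x, y) _).1.
have rd x y : ball x0 r x -> ball y0 r y -> forall w,
    `|partial2 f (x0, y0) w - partial2 f (x, y) w| <= (2 * K)^-1 * `|w|.
  move=> xr yr w; rewrite distrC -(norm_pair0 E w).
  by apply: (rP (x, y) _).2.
pose N x y := y - T' (f (x, y)).
have cN x y y' : ball x0 r x -> ball y0 r y -> ball y0 r y' ->
    `|N x y - N x y'| <= 2^-1 * `|y - y'|.
  move=> xr yr yr'.
  (* Newton's map is [T' \o g], and the derivative of [g] measures how far [D_y f] is from its value
     at the base point; the mean value inequality gives the contraction. *)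
  pose g y := partial2 f (x0, y0) y - f (x, y).
  have -> : N x y - N x y' = T' (g y - g y').
    by rewrite /N /g !T'B !TK.
  have gd z : ball y0 r z -> is_diff z g
      (fun w => partial2 f (x0, y0) w - partial2 f (x, z) w).
    move=> zr; have H := is_diff_partial2 (df _ (rO _ _ xr zr)).
    apply: (is_diffB _ H); apply: DiffDef.
      exact/linear_differentiable/partial2_continuous/df.
    exact/diff_lin/partial2_continuous/df.
  rewrite (le_trans (T'b _))// -(ler_pdivlMl _ _ K0) mulrA -invfM [K * 2]mulrC.
  apply: (@mean_value_ball _ _ _ g y0 r (2 * K)^-1 _ _ y' y yr' yr).
    by move=> z /gd[].
  by move=> z zr v; rewrite (is_diffE v (gd z zr)); exact: rd.
have norm0 (v : F) : `|v| <= 2^-1 * `|v| -> v = 0.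
  move=> v2; apply/eqP; rewrite -normr_le0; move: `|v| v2 => t ?; lra.
(* Zeros are fixed by Newton's map, so their distance is at most half of itself. *)
have uniq x y y' : ball x0 r x -> ball y0 r y -> ball y0 r y' ->
    f (x, y) = 0 -> f (x, y') = 0 -> y = y'.
  move=> xr yr yr' fy fy'; apply/eqP; rewrite -subr_eq0; apply/eqP/norm0.
  by have := cN _ _ _ xr yr yr'; rewrite /N fy fy' linear0 !subr0.
have cf x y : ball x0 r x -> ball y0 r y ->
    {for x, continuous (fun x => f (x, y))}.
  move=> xr yr; apply: (@continuous_comp _ _ _ (fun x => (x, y)) f).
    by apply: cvg_pair; [exact: cvg_id|exact: cvg_cst].
  exact/differentiable_continuous/df/rO.
have r2 : r / 2 < r by rewrite ltr_pdivrMr// ltr_pMr// ltr1n.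
(* The bound [r / 4 / K] makes Newton's first step at most [r / 4], as a closed ball of radius
   [r / 2] requires; this radius keeps the fixed point inside the open ball of radius [r]. *)
have [d d0 dP] : exists2 d, 0 < d & forall x, ball x0 d x ->
    ball x0 r x /\ `|f (x, y0)| <= r / 4 / K.
  have rK : 0 < r / 4 / K by rewrite !divr_gt0.
  have /cvgrPdist_le/(_ _ rK) := cf _ _ (ballxx x0 r0) (ballxx y0 r0).
  rewrite fz => near0.
  have : \forall x \near x0, ball x0 r x /\ `|f (x, y0)| <= r / 4 / K.
    near=> x; split; first by near: x; exact: nbhsx_ballx.
    by rewrite -normrN -sub0r; near: x.
  by move=> /nbhs_ballP[d /= d0 dP]; exists d.
(* Outside the ball [y0] is a default value, so that [choice] yields a total function. *)
have exu x : exists y, ball x0 d x -> ball y0 r y /\ f (x, y) = 0.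
  have [xd|nxd] := pselect (ball x0 d x); last by exists y0.
  have [xr fx] := dP _ xd.
  have br y : `|y - y0| <= r / 2 -> ball y0 r y.
    by move=> yr; rewrite -ball_normE /= distrC (le_lt_trans yr).
  have [|||y yr Ny] := @contraction_fixed_point R F (N x) y0 (r / 2).
  - by rewrite divr_ge0// ltW.
  - by move=> y y' /br yr /br yr'; exact: cN.
  - rewrite /N addrAC subrr sub0r normrN (le_trans (T'b _))//.
    rewrite -ler_pdivlMl// (le_trans fx)// mulrC ler_pM2l ?invr_gt0//; lra.
  exists y => _; split; first exact: br.
  rewrite -[f _]T'K; have -> : T' (f (x, y)) = 0.
    by move: Ny => /eqP; rewrite /N subr_eq addrC -subr_eq subrr eq_sym => /eqP.
  exact: linear0.
have [u uP] := choice exu.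
exists d, r, u; split.
- by split=> // -[x y] [/= /dP[xr _] yr]; exact: rO.
- by move=> x /uP.
- move=> x y xd yr fxy; have [ur fu] := uP _ xd; have [xr _] := dP _ xd.
  exact: uniq fxy fu.
- move=> x xd; have [xr _] := dP _ xd; have [ur fu] := uP _ xd.
  apply/cvgrPdist_le => e e0.
  have eK : 0 < e / (2 * K) by rewrite divr_gt0// mulr_gt0.
  have /cvgrPdist_le/(_ _ eK) := cf _ _ xr ur; rewrite fu => near0.
  near=> x'; have x'd : ball x0 d x'.
    by near: x'; apply: open_nbhs_nbhs; split => //; exact: ball_open.
  have [x'r _] := dP _ x'd; have [ur' fu'] := uP _ x'd.
  have fx' : `|f (x', u x)| <= e / (2 * K).
    by rewrite -normrN -sub0r; near: x'.
  (* At [x'], Newton's map fixes [u x'] and moves [u x] by at most [e / 2]; the contraction absorbs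
     half of the distance between the two. *)
  have := cN _ _ _ x'r ur ur'; rewrite /N fu' linear0 subr0.
  have Tfx' : `|T' (f (x', u x))| <= e / 2.
    rewrite (le_trans (T'b _))// -ler_pdivlMl// (le_trans fx')//.
    by rewrite invfM mulrA mulrC.
  have := ler_normD (u x - T' (f (x', u x)) - u x') (T' (f (x', u x))).
  rewrite addrAC subrK; move: Tfx'; move: `|T' _| `|u x - u x'| `|_ - _| => a b c.
  lra.
- move=> x y xd yr; have [xr _] := dP _ xd.
  apply: (bounded_iso_perturbation K0 TK T'K T'b _ (rd _ _ xr yr)).
  exact/partial2_continuous/df/rO.
Unshelve. all: by end_near. Qed.

End implicit_function.

(** * Smoothness of the implicit function by the tangent equation *)

Section implicit_function_smooth.
Context (R : realType).
Implicit Types (E F G : normedModType R).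

Lemma diff_pairE E F G (f : E * F -> G) (z : E * F) (v : E) (w : F) :
  'd f z (v, w) = 'd f z (v, 0) + partial2 f z w.
Proof.
rewrite /partial2 -linearD; congr ('d f z _).
by rewrite -[RHS]/(v + 0, 0 + w) addr0 add0r.
Qed.

(** Forward substitution: the first component determines [a], and [b] is then found from the second
    after subtracting [M a]. *)
Lemma bounded_iso_triangular (F G : normedModType R) (S : F * F -> G * G)
    (T : {linear F -> G}) (M : F -> G) :
  continuous S -> continuous M -> bounded_iso T ->
  (forall a b, S (a, b) = (T a, M a + T b)) -> bounded_iso S.
Proof.
move=> cS cM isoT SE; have [T' [K [TK T'K cT' _ _]]] := bounded_iso_inverse isoT.
split=> //; exists (fun y => (T' y.1, T' (y.2 - M (T' y.1)))); split.
- by move=> [a b]; rewrite SE/= TK addrC addKr TK.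
- by move=> [a b]; rewrite SE/= !T'K addrC subrK.
- have cT1 : continuous (fun y : G * G => T' y.1).
    by move=> y; apply: continuous_comp; [exact: cvg_fst|exact: cT'].
  move=> y; apply: cvg_pair; first exact: cT1.
  apply: (@continuous_comp _ _ _ (fun y : G * G => y.2 - M (T' y.1)) T');
    last exact: cT'.
  apply: cvgB; first exact: cvg_snd.
  by apply: (@continuous_comp _ _ _ (fun y : G * G => T' y.1) M);
    [exact: cT1|exact: cM].
Qed.

(** Along the graph the increments [h] and [k] satisfy [df (h, k) = o(h, k)]; applying [T'] gives
    [k - L h = o(h, k)], and a linear bound of [k] by [h] reduces the error to [o(h)]. *)
Lemma differentiable_implicit E F G (f : E * F -> G) (u : E -> F) (x : E) :
  differentiable f (x, u x) -> {for x, continuous u} ->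
  (\forall t \near x, f (t, u t) = 0) -> bounded_iso (partial2 f (x, u x)) ->
  differentiable u x /\ forall v, 'd f (x, u x) (v, 'd u x v) = 0.
Proof.
move=> df cu fu isoT.
have [T' [K [TK T'K cT' K0 T'b]]] := bounded_iso_inverse isoT.
(* [L] is minus the inverse of [D_y f] composed with [D_x f]. *)
pose L : {linear E -> F} := T' \o 'd f (x, u x) \o pair_fun -%R \0.
have cL : continuous L.
  have cp : continuous (pair_fun -%R (\0 : E -> F)).
    by apply: pair_fun_continuous; [exact: opp_continuous|exact: cst_continuous].
  move=> v; apply: (@continuous_comp _ _ _
    ('d f (x, u x) \o pair_fun -%R (\0 : E -> F)) T'); last exact: cT'.
  by apply: continuous_comp; [exact: cp|exact: (diff_continuous df)].
have LE h k : k - L h = T' ('d f (x, u x) (h, k)).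
  rewrite diff_pairE linearD/= TK addrC; congr (_ + _).
  rewrite /L/= -!linearN; congr (T' ('d f _ _)).
  by rewrite -[LHS]/(- - h, 0) opprK.
have [C C0 LC] := linear_lipschitz cL.
suff uL : is_diff x u L.
  split=> [|v]; first by case: uL.
  by rewrite (is_diffE v uL) -[LHS]T'K -LE subrr linear0.
apply: near_is_diff => // e e0.
(* The first bound gives [K * c <= 1 / 2], whence [k] is at most [2 * C + 1] times [h] in norm; the
   second then makes the total error at most [e] times [h]. *)
pose c := Num.min (2 * K)^-1 (e / (K * (2 * C + 2))).
have c0 : 0 < c.
  by rewrite lt_min invr_gt0 !mulr_gt0 ?invr_gt0 ?mulr_gt0 ?addr_gt0 ?mulr_gt0.
have cux : (fun t => (t, u t)) @ x --> (x, u x).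
  by apply: cvg_pair; [exact: cvg_id|exact: cu].
near=> t; set h := t - x; set k := u t - u x.
have fhk : `|'d f (x, u x) (h, k)| <= c * (`|h| + `|k|).
  have H : `|f (t, u t) - f (x, u x) - 'd f (x, u x) ((t, u t) - (x, u x))|
     <= c * `|(t, u t) - (x, u x)|.
    by near: t; exact: (cux _ (diff_near df c0)).
  have ft : f (t, u t) = 0 by near: t.
  move: H; rewrite ft (nbhs_singleton fu) subrr sub0r normrN => /le_trans; apply.
  rewrite ler_pM2l// -[_ - _]/(h, k) prod_normE/= ge_max.
  by rewrite lerDl lerDr !normr_ge0.
have kL : `|k - L h| <= K * c * (`|h| + `|k|).
  by rewrite LE (le_trans (T'b _))// -mulrA ler_pM2l.
have Kc2 : K * c <= 2^-1.
  rewrite -ler_pdivlMl// ge_min.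
  by rewrite -invfM [K * 2]mulrC lexx.
have Kce : K * c * (2 * C + 2) <= e.
  have C2 : 0 < 2 * C + 2 by rewrite addr_gt0 ?mulr_gt0.
  rewrite -ler_pdivlMr// -ler_pdivlMl// ge_min; apply/orP; right.
  by rewrite [leRHS]mulrC -mulrA -invfM [(_ + _) * K]mulrC.
have Lh := LC h.
have kLh : `|k| <= `|k - L h| + `|L h|.
  by rewrite -{1}(subrK (L h) k) ler_normD.
have hk : `|k| <= (2 * C + 1) * `|h|.
  have : `|k - L h| <= 2^-1 * (`|h| + `|k|).
    by rewrite (le_trans kL)// ler_wpM2r// addr_ge0.
  move: Lh kLh; move: `|k - L h| `|L h| `|h| `|k| => a b p q; lra.
rewrite (le_trans kL)//; apply: (@le_trans _ _ (K * c * ((2 * C + 2) * `|h|))).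
  rewrite ler_pM2l ?mulr_gt0//.
  by move: hk; move: `|h| `|k| => p q; lra.
by rewrite mulrA ler_wpM2r.
Unshelve. all: by end_near. Qed.

(** Supplies the continuity of the derivative of [u] that the tangent equation needs as a
    hypothesis. The constant [w0] solves that equation near the base point up to a defect tending to
    0, and the isomorphism turns a small defect into a small distance from the true derivative. *)
Lemma continuous_diff_implicit E F G (O : set (E * F)) (U : set E)
    (f : E * F -> G) (u : E -> F) :
  open U -> Cn 2 O f -> (forall x, U x -> O (x, u x)) ->
  (forall x, U x -> {for x, continuous u}) ->
  (forall x v, U x -> 'd f (x, u x) (v, 'd u x v) = 0) ->
  (forall x, U x -> bounded_iso (partial2 f (x, u x))) ->
  forall q, (U `*` @setT E) q -> {for q, continuous (tangent_map u)}.
Proof.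
move=> oU Cf Ou cu du isou [x0 v0] [/= Ux0 _].
have Ox0 := Ou _ Ux0.
have [T' [K [TK T'K cT' K0 T'b]]] := bounded_iso_inverse (isou _ Ux0).
have K20 : 0 < (2 * K)^-1 by rewrite invr_gt0 mulr_gt0.
pose w0 := 'd u x0 v0.
have cz : (fun q : E * E => (q.1, u q.1)) @ (x0, v0) --> (x0, u x0).
  apply: cvg_pair; first exact: cvg_fst.
  by apply: (cvg_comp fst u _ (cu _ Ux0)); exact: cvg_fst.
have cT : {for ((x0, u x0), (v0, w0)), continuous (tangent_map f)}.
  by have [_ [dT _]] := Cf; apply: differentiable_continuous; exact: dT.
have cq : (fun q : E * E => ((q.1, u q.1), (q.2, w0))) @ (x0, v0) -->
    ((x0, u x0), (v0, w0)).
  apply: (@cvg_pair _ _ _ (nbhs (x0, v0)) (nbhs (x0, u x0)) (nbhs (v0, w0)) _ _ _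
    (fun q : E * E => (q.1, u q.1)) (fun q : E * E => (q.2, w0)));
    first exact: cz.
  by apply: cvg_pair; [exact: cvg_snd|exact: cvg_cst].
apply/cvgrPdist_le => e e0.
have e'0 : 0 < e / (2 * K) by rewrite divr_gt0// mulr_gt0.
have T0 : tangent_map f ((x0, u x0), (v0, w0)) = 0 by exact: du.
have cTq : tangent_map f ((q.1, u q.1), (q.2, w0)) @[q --> (x0, v0)] -->
    tangent_map f ((x0, u x0), (v0, w0)).
  exact: cvg_comp cq cT.
have near0 : \forall q \near (x0, v0),
    `|tangent_map f ((q.1, u q.1), (q.2, w0))| <= e / (2 * K).
  have /cvgrPdist_le/(_ _ e'0) := cTq; rewrite T0.
  by apply: filterS => q; rewrite sub0r normrN.
near=> q.
have Uq : U q.1.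
  near: q; have : \forall x \near x0, U x by exact: open_nbhs_nbhs.
  by exact: (@cvg_fst _ _ (nbhs x0) (nbhs v0) _).
have fq : `|'d f (q.1, u q.1) (q.2, w0)| <= e / (2 * K).
  by near: q; exact: near0.
have Tq v : `|'d f (q.1, u q.1) v - 'd f (x0, u x0) v| <= (2 * K)^-1 * `|v|.
  by move: v; near: q; exact: (cz _ (diff_near_diff Cf Ox0 K20)).
have duq : 'd f (q.1, u q.1) (q.2, tangent_map u q) = 0 by exact: du.
set w := tangent_map u q in duq *.
(* Subtracting the tangent equation at [q] cancels the contribution of the direction [q.2]. *)
have Tw : partial2 f (q.1, u q.1) (w0 - w) = 'd f (q.1, u q.1) (q.2, w0).
  by rewrite linearB/= -[LHS]addr0 -duq diff_pairE [RHS]diff_pairE addrCA subrK.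
have := Tq (0, w0 - w); rewrite norm_pair0 -!/(partial2 _ _ _) Tw.
set A := 'd f _ _; set B := partial2 _ _ _ => AB.
have BK : K * `|B| <= K * (e / (2 * K) + (2 * K)^-1 * `|w0 - w|).
  rewrite ler_pM2l// -[B](subKr A) (le_trans (ler_normB _ _))//.
  exact: lerD.
have {}BK : K * `|B| <= e / 2 + 2^-1 * `|w0 - w|.
  rewrite (le_trans BK)// invfM mulrDr !mulrA ![_ * K^-1]mulrC !mulrA.
  by rewrite mulVf ?gt_eqF ?mul1r// mulrAC.
have : `|w0 - w| <= K * `|B| by rewrite -{1}[w0 - w]TK T'b.
rewrite -/w0; move: `|w0 - w| (K * _) BK => p t; lra.
Unshelve. all: by end_near. Qed.

(** Spaces, equation and solution all change in the induction, so all are generalized; smoothness of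
    every order is inherited by the tangent equation. *)
Lemma Cn_implicit n E F G (O : set (E * F)) (U : set E) (f : E * F -> G)
    (u : E -> F) :
  open O -> open U -> smooth O f -> (forall x, U x -> O (x, u x)) ->
  (forall x, U x -> {for x, continuous u}) ->
  (forall x, U x -> f (x, u x) = 0) ->
  (forall x, U x -> bounded_iso (partial2 f (x, u x))) ->
  Cn n U u.
Proof.
elim: n => [//|n IH] in E F G O U f u *; move=> oO oU sf Ou cu fu isou.
have df z : O z -> differentiable f z by exact: (sf 1%N).1.
have dTf z v : O z -> differentiable (tangent_map f) (z, v).
  by move=> Oz; exact: (sf 2%N).2.1.
have sTf m : Cn m (O `*` setT) (tangent_map f) by exact: (sf m.+1).2.
have du x : U x -> differentiable u x /\
    forall v, 'd f (x, u x) (v, 'd u x v) = 0.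
  move=> Ux; apply: differentiable_implicit; [exact/df/Ou|exact: cu| |exact: isou].
  have Un : \forall t \near x, U t by exact: open_nbhs_nbhs.
  by apply: filterS Un => t; exact: fu.
split; first by move=> x /du[].
(* [g] is the tangent equation, with unknowns [(y, w)] given [(x, v)]; [u'] is
   its solution and [A] reorders [((x, v), (y, w))] as [((x, y), (v, w))]. *)
pose A0 : {linear ((E * E) * (F * F))%type -> (E * F)%type} :=
  pair_fun (fst \o fst) (fst \o snd).
pose A1 : {linear ((E * E) * (F * F))%type -> (E * F)%type} :=
  pair_fun (snd \o fst) (snd \o snd).
pose A : {linear ((E * E) * (F * F))%type -> ((E * F) * (E * F))%type} :=
  pair_fun A0 A1.
have cA0 : continuous A0.
  by apply: pair_fun_continuous => z; apply: continuous_comp;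
    [exact: cvg_fst|exact: cvg_fst|exact: cvg_snd|exact: cvg_fst].
have cA1 : continuous A1.
  by apply: pair_fun_continuous => z; apply: continuous_comp;
    [exact: cvg_fst|exact: cvg_snd|exact: cvg_snd|exact: cvg_snd].
have cA : continuous A by exact: pair_fun_continuous.
pose g := pair_fun (f \o A0) (tangent_map f \o A).
pose O' := A0 @^-1` O.
have oO' : open O' by apply: open_comp => // z _; exact: cA0.
pose u' := pair_fun (u \o fst) (tangent_map u).
have sg : smooth O' g.
  move=> m; apply: Cn_pair => //; first exact: Cn_comp_linear.
  have := Cn_comp_linear (openX_setT oO) cA (sTf m).
  by apply: Cn_sub.
have oU' : open (U `*` @setT E) by exact: openX_setT.
have Cu' : Cn n (U `*` @setT E) u'.
  apply: (IH _ _ _ O' _ g) => //.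
  - by move=> [x v] [/= /Ou].
  - move=> [x v] [/= Ux _]; apply: cvg_pair.
      by apply: (cvg_comp fst u _ (cu _ Ux)); exact: cvg_fst.
    apply: (continuous_diff_implicit oU (sf 2%N)) => //.
    by move=> y w Uy; have [_] := du _ Uy; exact.
  - move=> [x v] [/= Ux _]; rewrite /g /pair_fun/= /tangent_map/=.
    by have [_ ->] := du _ Ux; rewrite fu.
  - move=> [x v] [/= Ux _].
    pose z := (x, u x); pose y := (v, 'd u x v).
    (* The off-diagonal block: the second derivative of [f] in the direction [(0, a)], applied to
       [y]. *)
    pose M a := 'd (tangent_map f) (z, y) ((0, a), 0).
    have Oz := Ou _ Ux; have dfz := df _ Oz; have dTz := dTf _ y Oz.
    apply: (@bounded_iso_triangular _ _ _ (partial2 f z) M).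
    + by apply: partial2_continuous; exact: (sg 1%N).1.
    + have ci : continuous
          (pair_fun (pair_fun (cst (0 : E)) (@id F)) (cst (0 : E * F))).
        apply: pair_fun_continuous; last exact: cst_continuous.
        by apply: pair_fun_continuous => [|t]; [exact: cst_continuous|exact: cvg_id].
      by move=> a; apply: continuous_comp; [exact: ci|exact: (diff_continuous dTz)].
    + exact: isou.
    + move=> a b; rewrite /partial2 /g.
      have dA0 q : differentiable A0 q by exact: linear_differentiable.
      have dA q : differentiable A q by exact: linear_differentiable.
      pose p : (E * E) * (F * F) := ((x, v), u' (x, v)).
      have d1 := differentiable_comp (dA0 p) (dfz : differentiable f (A0 p)).
      have d2 := differentiable_comp (dA p)
        (dTz : differentiable (tangent_map f) (A p)).
      rewrite (diff_pair d1 d2) (diff_comp (dA0 p) dfz) (diff_comp (dA p) dTz).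
      have Mb : 'd (tangent_map f) (z, y) ((0, a), (0, b)) = M a + 'd f z (0, b).
        by rewrite diff_pairE /partial2 diff_tangent_fiber.
      rewrite (diff_lin p cA0) (diff_lin p cA).
      exact: (congr1 (pair ('d f z (0, a))) Mb).
exact: (Cn_linear_comp (A := snd) oU' (@continuous_snd R F F) Cu').
Qed.

End implicit_function_smooth.

(** * Open sets and smooth maps in charts *)

Section charts.
Context (R : realType).
Implicit Types (E F H : normedModType R).

Lemma linear_fun0 E F (f : E -> F) : linear f -> f 0 = 0.
Proof.
move=> /(_ 1 0 0); rewrite scaler0 addr0 scale1r => /eqP.
by rewrite -subr_eq subrr eq_sym => /eqP.
Qed.

Lemma open_preimage_within (X Z : topologicalType) (D : set X) (V : set Z)
    (g : X -> Z) :
  open D -> open V -> (forall x, D x -> {for x, continuous g}) ->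
  open [set x | D x /\ V (g x)].
Proof.
move=> oD oV cg; rewrite openE => x [Dx Vgx]; apply: filterI.
  exact: open_nbhs_nbhs.
by apply: (cg _ Dx); exact: open_nbhs_nbhs.
Qed.

Lemma cinvP E (M : topologicalType) (c : chart E M) (y : E) :
  ctgt c y -> cdom c (cinv c y) /\ c (cinv c y) = y.
Proof. by move=> [x cx <-]; rewrite cmapK. Qed.

Lemma open_chart_preimage E (M : topologicalType) (c : chart E M) (V : set E) :
  open V -> open [set x | cdom c x /\ V (c x)].
Proof.
move=> oV.
exact: open_preimage_within (@cdom_open _ _ _ c) oV (@cmap_cont _ _ _ c).
Qed.

Lemma open_chart_image E (M : topologicalType) (c : chart E M) (W : set M) :
  open W -> W `<=` cdom c -> open (c @` W).
Proof.
move=> oW Wc.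
have -> : c @` W = [set y | ctgt c y /\ W (cinv c y)].
  apply/seteqP; split => [_ [x Wx <-]|y [/cinvP[cy yE] Wy]].
    by split; [exists x => //; exact: Wc|rewrite cmapK//; exact: Wc].
  by exists (cinv c y).
exact: open_preimage_within (@ctgt_open _ _ _ c) oW (@cinv_cont _ _ _ c).
Qed.

Lemma open_chart2_image E F (A B : topologicalType) (a : chart E A)
    (b : chart F B) (O : set (A * B)) :
  open O -> O `<=` cdom a `*` cdom b ->
  open [set (a z.1, b z.2) | z in O].
Proof.
move=> oO Oab.
have -> : [set (a z.1, b z.2) | z in O] =
    [set y | (ctgt a `*` ctgt b) y /\ O (cinv a y.1, cinv b y.2)].
  apply/seteqP; split => [_ [[x y] Oz <-]|].
    have [/= ax bx] := Oab _ Oz.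
    by rewrite /= !cmapK//; split => //; split; [exists x|exists y].
  move=> [x y] [/= [/cinvP[ax xE] /cinvP[bx yE]] Oxy].
  by exists (cinv a x, cinv b y) => //=; rewrite xE yE.
apply: open_preimage_within oO _.
  rewrite openE => -[x y] [/= ax bx]; exists (ctgt a, ctgt b) => //=.
  by split; apply: open_nbhs_nbhs; split => //; exact: ctgt_open.
move=> [x y] [/= ax bx]; apply: cvg_pair.
  by apply: (cvg_comp fst (cinv a) _ (cinv_cont ax)); exact: cvg_fst.
by apply: (cvg_comp snd (cinv b) _ (cinv_cont bx)); exact: cvg_snd.
Qed.

Lemma smooth_on_id E (A : manifold E) (Z : set A) : smooth_on Z (@id A).
Proof.
split=> [x _|a b aA bA n]; first exact: cvg_id.
apply: Cn_sub (atlas_compat aA bA n).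
by move=> _ [x [_ ax bx] <-]; exists x.
Qed.

Lemma smooth_on_sub E F (A : manifold E) (B : manifold F) (Z W : set A)
    (f : A -> B) : W `<=` Z -> smooth_on Z f -> smooth_on W f.
Proof.
move=> WZ [cf sf]; split=> [x /WZ|a b aA bB n]; first exact: cf.
apply: Cn_sub (sf a b aA bB n).
by move=> _ [x [/WZ Zx ax bx] <-]; exists x.
Qed.

(** In charts the map factors as [k], then [u], then a transition map of the target. The parameter
    [k] lets one statement serve both for the solution map and for its pull-back to a family. *)
Lemma smooth_on_local_rep E F H (X : manifold H) (A : manifold E)
    (B : manifold F) (Z : set X) (k : X -> A) (a : chart E A) (b : chart F B)
    (D : set E) (u : E -> F) :
  open Z -> smooth_on Z k -> atlas a -> atlas b -> open D -> smooth D u ->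
  (forall x, Z x -> [/\ cdom a (k x), D (a (k x)) & ctgt b (u (a (k x)))]) ->
  smooth_on Z (fun x => cinv b (u (a (k x)))).
Proof.
move=> oZ [ck sk] aA bB oD su ZD.
pose g x := cinv b (u (a (k x))).
have cg x : Z x -> {for x, continuous g}.
  move=> Zx; have [ax Dx bx] := ZD _ Zx.
  apply: (@continuous_comp _ _ _ k (cinv b \o u \o a)); first exact: ck.
  apply: (@continuous_comp _ _ _ a (cinv b \o u)); first exact: cmap_cont.
  by apply: continuous_comp; [exact: (su 0%N)|exact: cinv_cont].
split; first exact: cg.
move=> c b' cX b'B n; set W := [set x | _].
have oW : open W.
  rewrite (_ : W = [set x | Z x /\ cdom b' (g x)] `&` cdom c).
    apply: openI; last exact: cdom_open.
    exact: open_preimage_within oZ (@cdom_open _ _ _ b') cg.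
  by apply/seteqP; split => x [] // [].
have ocW : open (c @` W) by apply: open_chart_image => // x [].
pose T := b @` (cdom b `&` cdom b').
have oT : open T.
  by apply: open_chart_image => [|x []//]; apply: openI; exact: cdom_open.
have Ck : Cn n (c @` W) (a \o k \o cinv c).
  apply: Cn_sub (sk c a cX aA n) => _ [x [Zx cx _] <-].
  by exists x => //; split => //; have [] := ZD _ Zx.
have Cu : Cn n (c @` W) (u \o (a \o k \o cinv c)).
  apply: Cn_comp ocW oD _ Ck (su n) => _ [x [Zx cx _] <-] /=.
  by rewrite cmapK//; have [] := ZD _ Zx.
apply: Cn_comp ocW oT _ Cu (atlas_compat bB b'B n) => _ [x [Zx cx bx] <-] /=.
have [_ _ /cinvP[gb gE]] := ZD _ Zx.
by rewrite cmapK//; exists (g x) => //; rewrite /g gE.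
Qed.

End charts.

(** * Harmonic probes from the implicit function in charts *)

Theorem theorem3p3 (R : realType) (d m n s : nat)
  (* cohomogeneity-one manifold *)
  (G : lie_group R d)
  (M : manifold 'rV[R]_m) (hM : compact_manifold M)
  (actM : G -> M -> M) (hactM : smooth_action actM)
  (hcoh : cohomogeneity_one actM)
  (q : M -> R) (hq : orbit_interval actM q)
  (* fixed normal geodesic and Einstein constant *)
  (L : R) (hL : 0 < L) (gamma : R -> M)
  (lambda : R) (hlambda : 0 < lambda)
  (* target *)
  (N : manifold 'rV[R]_n) (hN : compact_manifold N)
  (h : N -> 'M[R]_n) (hh : smooth_metric h)
  (actN : G -> N -> N) (hactN : smooth_action actN)
  (hinv : invariant_metric actN h)
  (* regularity *)
  (k : nat) (hk : (4 <= k)%N) (alpha : R) (halpha : 0 < alpha < 1)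
  (* Banach manifold of normalized metrics *)
  (EG : completeNormedModType R) (GG : manifold EG)
  (metric : GG -> M -> 'M[R]_m) (hmetric_inj : injective metric)
  (hmetric : forall g, normalized_metric actM q L gamma (metric g))
  (* smooth parameterized Einstein family *)
  (S : manifold 'rV[R]_s) (hS : smooth_manifold S)
  (gS : S -> GG) (hgS : smooth_on setT gS)
  (heinstein : forall p, einstein lambda (metric (gS p)))
  (hcoef : forall a c, atlas a -> atlas c ->
     smooth (ctgt a `*` ctgt c)
            (fun z : 'rV[R]_s * 'rV[R]_m =>
               metric_in (metric (gS (cinv a z.1))) c z.2))
  (p0 : S) (g0 : GG) (hp0 : gS p0 = g0)
  (* Banach manifold of admissible maps, containing the reference map *)
  (admissible : set (M -> N))
  (EH : completeNormedModType R) (HH : manifold EH)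
  (map_of : HH -> M -> N) (f0 : HH)
  (hHH : mapping_submanifold h (k + 2) alpha
     [set f | [/\ holder_map (k + 2) alpha f, equivariant actM actN f,
                  equivariant_homotopic actM actN (map_of f0) f
                & admissible f]] map_of)
  (* Banach bundle of equivariant sections, and the tension field *)
  (Y : banach_bundle HH) (sec : forall f, Y f -> M -> 'rV[R]_n)
  (hY : section_bundle actM actN h k alpha map_of sec)
  (F : forall (g : GG) (f : HH), Y f)
  (hF : forall g f x, sec f (F g f) x = tension (metric g) h (map_of f) x)
  (hf0 : F g0 f0 = 0)
  (* smoothness of F in the trivialization centred at f0 *)
  (hFsmooth : exists2 O : set (GG * HH), open_nbhs (g0, f0) O &
     O `<=` [set z | tdom Y f0 z.2] /\
     smooth2_on O ((fun g f => triv f0 (F g f))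
                     : GG -> HH -> model (Y f0)))
  (* the Jacobi operator is a bounded isomorphism *)
  (hJ : bounded_iso
     (mdiff ((fun f => triv f0 (F g0 f)) : HH -> model (Y f0)) f0)) :
  exists (U : set GG) (V : set HH) (Pi : GG -> HH),
    [/\ open_nbhs g0 U, open_nbhs f0 V,
        (* Pi is the unique smooth map of solutions *)
        [/\ smooth_on U Pi, Pi @` U `<=` V, forall g, U g -> F g (Pi g) = 0,
            Pi g0 = f0
          & forall Pi' : GG -> HH,
              smooth_on U Pi' -> Pi' @` U `<=` V ->
              (forall g, U g -> F g (Pi' g) = 0) ->
              forall g, U g -> Pi' g = Pi g],
        forall g f, U g -> V f -> F g f = 0 -> f = Pi g
      & let SU := gS @^-1` U in
        [/\ open_nbhs p0 SU,
            smooth_on SU (Pi \o gS),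
            forall p, SU p -> V (Pi (gS p)) /\
              forall x, tension (metric (gS p)) h (map_of (Pi (gS p))) x = 0
          & forall (W : set S) (phi : S -> HH), W `<=` SU ->
              (forall p, W p -> V (phi p) /\
                 forall x, tension (metric (gS p)) h (map_of (phi p)) x = 0) ->
              forall p, W p -> phi p = Pi (gS p)]].
Proof.
pose a := chart_at g0; pose b := chart_at f0.
have aA : atlas a by exact: chart_at_atlas.
have bA : atlas b by exact: chart_at_atlas.
have ag0 : cdom a g0 by exact: chart_at_dom.
have bf0 : cdom b f0 by exact: chart_at_dom.
have [W [openW W0] [Wtriv [_ sF]]] := hFsmooth.
pose f (y : EG * EH) : Y f0 := triv f0 (F (cinv a y.1) (cinv b y.2)).
pose D := [set (a z.1, b z.2) | z in W `&` cdom a `*` cdom b].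
have oD : open D.
  apply: open_chart2_image => [|z []//]; apply: openI => //.
  rewrite openE => -[g f'] [/= ag bf']; exists (cdom a, cdom b) => //=.
  by split; apply: open_nbhs_nbhs; split => //; exact: cdom_open.
have sf : smooth D f.
  (* The fibre over [f0] is a model space with the identity chart, so [f] is the local expression of
     the trivialized tension field. *)
  move=> l; apply: Cn_sub (sF a b (id_chart _) aA bA erefl l).
  by move=> _ [z [Wz [az bz]] <-]; exists z.
have DW x y : D (x, y) -> W (cinv a x, cinv b y) /\ ctgt b y.
  move=> [[g' f'] [Wz [/= az bz]] [<- <-]]; rewrite !cmapK//.
  by split => //; exists f'.
have trivE g f' : W (g, f') -> triv f0 (F g f') = 0 <-> F g f' = 0.
  move=> /Wtriv/= tf'; have triv0 := linear_fun0 (triv_linear tf').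
  split=> [Ff|->]; last exact: triv0.
  by apply: (can_inj (trivK tf')); rewrite Ff triv0.
have Dz : D (a g0, b f0) by exists (g0, f0).
have fz : f (a g0, b f0) = 0.
  by rewrite /f/= !cmapK//; exact/trivE.
have isof : bounded_iso (partial2 f (a g0, b f0)).
  have df : differentiable f (a g0, b f0) by exact: (sf 1%N).1.
  (* Since [b] is the preferred chart at [f0], the partial derivative is the Jacobi operator
     itself. *)
  suff -> : partial2 f (a g0, b f0) =
      mdiff ((fun f' => triv f0 (F g0 f')) : HH -> model (Y f0)) f0 by [].
  apply/funext => w; rewrite -[LHS](is_diffE w (is_diff_partial2 df)) /=.
  by rewrite /mdiff /f/= cmapK.
have [dd [r [u [[d0 r0 Dball] uP uuniq cu isou]]]] :=
  implicit_function oD (sf 2%N) Dz fz isof.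
have su : smooth (ball (a g0) dd) u.
  have uD x : ball (a g0) dd x -> D (x, u x).
    by move=> xd; apply: Dball; split => //; exact: (uP _ xd).1.
  have isou' x : ball (a g0) dd x -> bounded_iso (partial2 f (x, u x)).
    by move=> xd; apply: isou => //; exact: (uP _ xd).1.
  have fu x (xd : ball (a g0) dd x) := (uP x xd).2.
  by move=> l; exact: (Cn_implicit l oD (ball_open _ _) sf uD cu fu isou').
pose U := [set g | cdom a g /\ ball (a g0) dd (a g)].
pose V := [set f' | cdom b f' /\ ball (b f0) r (b f')].
pose Pi g := cinv b (u (a g)).
have oU : open U by apply: open_chart_preimage; exact: ball_open.
have oV : open V by apply: open_chart_preimage; exact: ball_open.
(* The product of balls lies in [D], which consists of chart images; hence [cinv b] takes genuine
   values on the ball around [b f0]. *)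
have WUV g y : U g -> ball (b f0) r y -> W (g, cinv b y) /\ ctgt b y.
  move=> [ag gd] yr; have := DW (a g) y (Dball (_, _) (conj gd yr)).
  by rewrite cmapK.
have PiP g : U g -> V (Pi g) /\ F g (Pi g) = 0.
  move=> Ug; have [ag gd] := Ug; have [ur fu] := uP _ gd.
  have [Wg /cinvP[bP bE]] := WUV _ _ Ug ur.
  split; first by rewrite /V /Pi/= bE.
  by apply/(trivE _ _ Wg); move: fu; rewrite /f/= cmapK.
have uniq g f' : U g -> V f' -> F g f' = 0 -> f' = Pi g.
  move=> Ug [bf' fr] Fgf; have [ag gd] := Ug.
  have [Wg _] := WUV _ _ Ug fr.
  rewrite /Pi -(uuniq _ _ gd fr) ?cmapK//.
  by rewrite /f/= !cmapK// in Wg *; exact/trivE.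
have sPi : smooth_on U Pi.
  apply: (smooth_on_local_rep (k := id) (D := ball (a g0) dd)) => //.
  - exact: smooth_on_id.
  - exact: ball_open.
  - move=> g Ug; have [ag gd] := Ug; split => //.
    by have [] := WUV _ _ Ug (uP _ gd).1.
have Ug0 : U g0 by split => //; exact: ballxx.
have Vf0 : V f0 by split => //; exact: ballxx.
(* Evaluation of sections is linear and injective, so vanishing in the fibre is pointwise vanishing
   of the tension field. *)
have FE g f' : F g f' = 0 <-> forall x, tension (metric g) h (map_of f') x = 0.
  have [evL evI _ _] := hY.1 f'.
  have ev0 x : sec f' 0 x = 0.
    by apply: (linear_fun0 (f := (sec f')^~ x)) => c s1 s2; exact: evL.
  split=> [Fgf x|Fgf]; first by rewrite -hF Fgf ev0.
  by apply: evI; apply/funext => x; rewrite hF Fgf ev0.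
exists U, V, Pi; split.
- by split.
- by split.
- split => //.
  + by move=> _ [g Ug <-]; have [] := PiP _ Ug.
  + by move=> g /PiP[].
  + by apply/esym/uniq.
  + move=> Pi' _ Pi'V FPi' g Ug; apply: uniq => //; last exact: FPi'.
    by apply: Pi'V; exists g.
- by move=> g f' Ug Vf' /(uniq _ _ Ug Vf').
- move=> SU; have oSU : open SU.
    by apply: open_comp => // p _; exact: hgS.1.
  split.
  + by split => //; rewrite /SU/= hp0.
  + apply: (smooth_on_local_rep (k := gS) (D := ball (a g0) dd)) => //.
    * exact: smooth_on_sub hgS.
    * exact: ball_open.
    * move=> p Up; have [ag gd] := Up; split => //.
      by have [] := WUV _ _ Up (uP _ gd).1.
  + by move=> p /PiP[VP FP]; split => //; apply/FE.
  + move=> Z phi ZSU phiP p Wp; have [Vp tp] := phiP _ Wp.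
    by apply: uniq => //; [exact: ZSU|exact/FE].
Qed.
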